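(* Let $m,n\ge1$ and $V=\mathbb C^{m+1}$ with the standard volume form $\langle u_1,\dots,u_{m+1}\rangle=\det(u_1,\dots,u_{m+1})$. Consider the coordinate ring of $V^{2n}\times SL(V)$, with points $(v_1,\dots,v_n,w_1,\dots,w_n,A)$. Extend the indices to all of $\mathbb Z$ by $v_{k+n}=Av_k$ and $w_{k+n}=Aw_k$ for all $k\in\mathbb Z$. The following $2mn+2n$ polynomial functions, all lying in the ring $\mathbb C[V^{2n}\times SL(V)]^{SL(V)}$ of $SL(V)$-invariants (with $SL(V)$ acting on vectors and on itself by conjugation), are algebraically independent over $\mathbb C$: (a) $\langle v_i,v_{i+1},\dots,v_{i+m}\rangle$ for $i=1,\dots,n$; (b) $\langle w_i,w_{i-1},\dots,w_{i-m}\rangle$ for $i=1,\dots,n$; (c) $\langle v_i,\dots,v_{i+\alpha-1},w_i,w_{i-1},\dots,w_{i-\beta+1}\rangle$ for $i=1,\dots,n$ and $\alpha+\beta=m+1$, $\alpha,\beta\ge1$; (d) $\langle v_i,\dots,v_{i+\alpha-1},w_{i-1},w_{i-2},\dots,w_{i-\beta}\rangle$ for $i=1,\dots,n$ and $\alpha+\beta=m+1$, $\alpha,\beta\ge1$.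
   Context: $SL(V)$ acts on $V$ naturally and on $SL(V)$ by conjugation; all the listed functions are invariant under the induced action. Here $\langle\cdot\rangle$ denotes the determinant of the matrix whose columns are the listed $m+1$ vectors. *)

(* Defs.v *)
From HB Require Import structures.
From mathcomp Require Import all_boot all_order all_algebra.
From mathcomp Require Import reals.
From mathcomp Require Import mpoly.
From mathcomp.real_closed Require Import complex.

Set Implicit Arguments.
Unset Strict Implicit.
Unset Printing Implicit Defensive.

Import Order.TTheory GRing.Theory Num.Theory.
Local Open Scope ring_scope.

Definition SL (K : fieldType) (m : nat) : Type :=
  {A : 'M[K]_m.+1 | \det A == 1}.

(* The points of V^{2n} x SL(V), with V = K^{m+1}. *)
Record point (K : fieldType) (m n : nat) : Type := Point {
  pv : n.-tuple 'cV[K]_m.+1;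
  pw : n.-tuple 'cV[K]_m.+1;
  pA : SL K m
}.

Lemma SL_conj_subproof (K : fieldType) (m : nat) (g A : SL K m) :
  \det (sval g *m sval A *m invmx (sval g)) == 1.
Proof.
case: g A => [g /= /eqP dg] [A /= /eqP dA].
by rewrite !det_mulmx det_inv dg dA invr1 !mulr1.
Qed.

Definition SL_conj (K : fieldType) (m : nat) (g A : SL K m) : SL K m :=
  exist (fun B : 'M[K]_m.+1 => is_true (\det B == 1))
    (sval g *m sval A *m invmx (sval g)) (SL_conj_subproof g A).

Definition SL_act (K : fieldType) (m n : nat) (g : SL K m)
    (x : point K m n) : point K m n :=
  Point (map_tuple (mulmx (sval g)) (pv x))
        (map_tuple (mulmx (sval g)) (pw x))
        (SL_conj g (pA x)).

(* The indices of the coordinate functions on the ambient affine space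
   V^{2n} x End(V). *)
Definition coord_index (m n : nat) : finType :=
  ('I_n * 'I_m.+1 + 'I_n * 'I_m.+1 + 'I_m.+1 * 'I_m.+1)%type.

Definition point_coord (K : fieldType) (m n : nat) (c : coord_index m n)
    (x : point K m n) : K :=
  match c with
  | inl (inl (i, r)) => tnth (pv x) i r 0
  | inl (inr (i, r)) => tnth (pw x) i r 0
  | inr (r, s) => sval (pA x) r s
  end.

(* K[V^{2n} x SL(V)], as the ring of functions on the variety that are
   restrictions of polynomials in the ambient coordinates. *)
Definition in_coordinate_ring (K : fieldType) (m n : nat)
    (f : point K m n -> K) : Prop :=
  exists p : {mpoly K[#|coord_index m n|]},
    forall x, f x = p.@[fun k => point_coord (enum_val k) x].

Definition SL_invariant (K : fieldType) (m n : nat)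
    (f : point K m n -> K) : Prop :=
  forall (g : SL K m) (x : point K m n), f (SL_act g x) = f x.

Definition in_invariant_ring (K : fieldType) (m n : nat)
    (f : point K m n -> K) : Prop :=
  in_coordinate_ring f /\ SL_invariant f.

(* Algebraic independence over K, in a ring of K-valued functions on X, of a
   family indexed by a finite type: only the zero polynomial relation holds
   identically on X. *)
Definition alg_independent (K : fieldType) (X : Type) (T : finType)
    (f : T -> X -> K) : Prop :=
  forall p : {mpoly K[#|T|]},
    (forall x, p.@[fun k => f (enum_val k) x] = 0) -> p = 0.

(* The extension of (u_1, ..., u_n) to all of Z with u_{k+n} = A u_k; the tuple
   is numbered from 0, so u_k is its entry k - 1 when 1 <= k <= n.
   See extE and extDn. *)
Definition ext (K : fieldType) (m n : nat) (A : 'M[K]_m.+1)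
    (u : n.-tuple 'cV[K]_m.+1) (k : int) : 'cV[K]_m.+1 :=
  (A ^ ((k - 1) %/ n%:Z)%Z : 'M[K]_m.+1) *m u`_(`|((k - 1) %% n%:Z)%Z|%N).

Lemma extE (K : fieldType) (m n : nat) (A : 'M[K]_m.+1)
    (u : n.-tuple 'cV[K]_m.+1) (i : 'I_n) : ext A u i.+1%:Z = tnth u i.
Proof.
have n0 : (0 <= i%:Z < `|n%:Z|%N%:Z) by rewrite /= ltz_nat ltn_ord.
have -> : ext A u i.+1%:Z
    = (A ^ (i%:Z %/ n%:Z)%Z : 'M[K]_m.+1) *m u`_(`|(i%:Z %% n%:Z)%Z|%N).
  by rewrite /ext (_ : i.+1%:Z - 1 = i%:Z) // -addn1 PoszD addrK.
by rewrite divz_small // modz_small // expr0z mul1mx (tnth_nth 0).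
Qed.

Lemma extDn (K : fieldType) (m n : nat) (hn : (1 <= n)%N) (A : SL K m)
    (u : n.-tuple 'cV[K]_m.+1) (k : int) :
  ext (sval A) u (k + n%:Z) = sval A *m ext (sval A) u k.
Proof.
case: A => [A /= /eqP dA].
have uA : A \is a GRing.unit by rewrite -[_ \is a _]/(A \in unitmx) unitmxE dA unitr1.
have n0 : n%:Z != 0 by rewrite eqz_nat -lt0n.
rewrite /ext addrAC modzDr (divzDr (k - 1) (dvdzz n%:Z)) divzz n0.
by rewrite [(_ %/ _)%Z + _]addrC exprzDr // expr1z mulmxA.
Qed.

(* <u_0, ..., u_m>: the determinant of the matrix with columns u_j. *)
Definition bracket (K : fieldType) (m : nat) (u : nat -> 'cV[K]_m.+1) : K :=
  \det (\matrix_(r < m.+1, j < m.+1) u j r 0).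

(* The four summands index fun_a, fun_b, fun_c, fun_d below, in that order.
   An i : 'I_n encodes the index i + 1 in {1, ..., n}, and an a : 'I_m encodes
   alpha = a + 1 in {1, ..., m}; then beta = m + 1 - alpha. *)
Definition family_index (m n : nat) : finType :=
  ('I_n + 'I_n + 'I_n * 'I_m + 'I_n * 'I_m)%type.

Lemma card_family_index (m n : nat) :
  #|family_index m n| = (2 * m * n + 2 * n)%N.
Proof.
rewrite !card_sum !card_prod !card_ord -mulnA !mul2n -!addnn (mulnC m n).
by rewrite -addnA addnC.
Qed.

Definition ext_v (K : fieldType) (m n : nat) (x : point K m n) (k : int) :
  'cV[K]_m.+1 := ext (sval (pA x)) (pv x) k.

Definition ext_w (K : fieldType) (m n : nat) (x : point K m n) (k : int) :
  'cV[K]_m.+1 := ext (sval (pA x)) (pw x) k.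

(* <v_i, v_{i+1}, ..., v_{i+m}> *)
Definition fun_a (K : fieldType) (m n : nat) (i : int) (x : point K m n) : K :=
  bracket (fun j => ext_v x (i + j%:Z)).

(* <w_i, w_{i-1}, ..., w_{i-m}> *)
Definition fun_b (K : fieldType) (m n : nat) (i : int) (x : point K m n) : K :=
  bracket (fun j => ext_w x (i - j%:Z)).

(* <v_i, ..., v_{i+alpha-1}, w_i, w_{i-1}, ..., w_{i-beta+1}> *)
Definition fun_c (K : fieldType) (m n : nat) (i : int) (alpha : nat)
    (x : point K m n) : K :=
  bracket (fun j => if (j < alpha)%N then ext_v x (i + j%:Z)
                    else ext_w x (i - (j - alpha)%N%:Z)).

(* <v_i, ..., v_{i+alpha-1}, w_{i-1}, w_{i-2}, ..., w_{i-beta}> *)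
Definition fun_d (K : fieldType) (m n : nat) (i : int) (alpha : nat)
    (x : point K m n) : K :=
  bracket (fun j => if (j < alpha)%N then ext_v x (i + j%:Z)
                    else ext_w x (i - 1 - (j - alpha)%N%:Z)).

Definition bracket_fun (K : fieldType) (m n : nat) (t : family_index m n)
    (x : point K m n) : K :=
  match t with
  | inl (inl (inl i)) => fun_a i.+1%:Z x
  | inl (inl (inr i)) => fun_b i.+1%:Z x
  | inl (inr (i, a)) => fun_c i.+1%:Z a.+1 x
  | inr (i, a) => fun_d i.+1%:Z a.+1 x
  end.

(* Main.v *)
(** The bracket functions take all tuples of nonzero values, and a polynomial
    vanishing off the coordinate hyperplanes is zero.

    To realize prescribed values, consider the flags F_k of v_k, v_(k+1), ...
    and G_k of w_k, w_(k-1), ....  The functions (c) are the relative position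
    of (F_k, G_k), and (d) that of (F_k, G_(k-1)); each such pair of transverse
    flags has a common adapted basis.  Passing from (F_(k-1), G_(k-1)) to
    (F_k, G_(k-1)) multiplies this basis by a lower bidiagonal matrix M_k, and
    passing back from (F_k, G_k) to (F_k, G_(k-1)) multiplies it by an upper
    bidiagonal matrix N_k.  With the entries of M_k and N_k taken to be ratios
    of the prescribed values, the products of the M_k N_k^-1 give all the bases,
    v_k and w_k are multiples of the first and last basis vectors, and A is the
    monodromy after n steps. *)
Require Import Defs.
From mathcomp Require Import all_boot all_order all_algebra.
From mathcomp Require Import reals.
From mathcomp Require Import mpoly.
From mathcomp Require Import perm zify.
From mathcomp.real_closed Require Import complex.

Set Implicit Arguments.
Unset Strict Implicit.
Unset Printing Implicit Defensive.

Import Order.TTheory GRing.Theory Num.Theory.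
Local Open Scope ring_scope.

(** * Polynomials vanishing off the coordinate hyperplanes *)

(** Reduction modulo [B] recovers the lowest digit; cancelling it and dividing by [B] leaves a
    shorter expansion. *)
Lemma base_expansion_inj (B n : nat) (a b : 'I_n -> nat) :
  (forall i, a i < B)%N -> (forall i, b i < B)%N ->
  (\sum_i a i * B ^ i = \sum_i b i * B ^ i)%N -> a =1 b.
Proof.
elim: n a b => [|n IHn] a b ltaB ltbB; first by move=> _ [].
have split_digit (c : 'I_n.+1 -> nat) :
    (\sum_i c i * B ^ i = (\sum_i c (lift ord0 i) * B ^ i) * B + c ord0)%N.
  rewrite big_ord_recl expn0 muln1 addnC; congr (_ + _)%N.
  rewrite big_distrl; apply: eq_bigr => i _.
  by rewrite /= /bump /= add1n expnSr mulnA.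
rewrite !split_digit => eq_ab.
have B_gt0 : (0 < B)%N by apply: leq_ltn_trans (ltaB ord0).
have eq0 : a ord0 = b ord0.
  have /(congr1 (fun s => (s %% B)%N)) := eq_ab.
  by rewrite !modnMDl !modn_small.
have eqS : (fun i => a (lift ord0 i)) =1 (fun i => b (lift ord0 i)).
  apply: IHn => // ; apply/eqP; rewrite -(eqn_pmul2r B_gt0).
  by rewrite -(eqn_add2r (a ord0)) eq_ab eq0.
by move=> i; case: (unliftP ord0 i) => [j ->|-> //]; apply: eqS.
Qed.

(** In characteristic zero 1, 2, ..., [size p] are distinct nonzero roots, more than the degree
    allows. *)
Lemma poly_eq0_off0 (F : numDomainType) (p : {poly F}) :
  (forall t, t != 0 -> p.[t] = 0) -> p = 0.
Proof.
move=> p0; pose rs := [seq k.+1%:R : F | k <- iota 0 (size p)].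
apply: (roots_geq_poly_eq0 (rs := rs)); last by rewrite size_map size_iota.
  by apply/allP => _ /mapP[k _ ->]; rewrite /root p0 // pnatr_eq0.
by rewrite map_inj_uniq ?iota_uniq // => i j /eqP; rewrite eqr_nat => /eqP[].
Qed.

(* Kronecker substitution: at the points (t ^ B ^ i)_i, with B exceeding all
   exponents, distinct monomials become distinct powers of t. *)
Lemma mpoly_eq0_off_hyperplanes (F : numDomainType) (N : nat)
    (p : {mpoly F[N]}) :
  (forall y : 'I_N -> F, (forall i, y i != 0) -> p.@[y] = 0) -> p = 0.
Proof.
move=> p0; pose B := msize p.
pose e (mon : 'X_{1..N}) := (\sum_i mon i * B ^ i)%N.
have mon_lt (mon : 'X_{1..N}) i : mon \in msupp p -> (mon i < B)%N.
  move=> /msize_mdeg_lt; apply: leq_ltn_trans.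
  by rewrite mdegE (bigD1 i) //= leq_addr.
have e_inj : {in msupp p &, injective e}.
  move=> m1 m2 m1p m2p /base_expansion_inj eq12.
  by apply/mnmP => i; apply: eq12 => j; apply: mon_lt.
pose q := \sum_(mon <- msupp p) p@_mon *: 'X^(e mon).
have q0 : q = 0.
  apply: poly_eq0_off0 => t t_neq0.
  rewrite -(p0 (fun i => t ^+ (B ^ i)%N)); last by move=> i; rewrite expf_neq0.
  rewrite mevalE horner_sum; apply: eq_bigr => mon _.
  rewrite hornerZ hornerXn expr_sum; congr (_ * _).
  by apply: eq_bigr => i _; rewrite -exprM mulnC.
apply/mpolyP => mon; rewrite mcoeff0.
have [mon_p|] := boolP (mon \in msupp p); last by rewrite mcoeff_msupp negbK => /eqP.
(* Since [e] is injective on the support, the coefficient of [q] at [e mon] is exactly that of [p]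
   at [mon]. *)
have := congr1 (coefp (e mon)) q0; rewrite /= coef0 coef_sum.
rewrite (bigD1_seq mon) ?msupp_uniq //= coefZ coefXn eqxx mulr1.
rewrite big_seq_cond big1 ?addr0 // => m' /andP[m'_p neq].
rewrite coefZ coefXn (inj_in_eq e_inj) //.
by rewrite eq_sym (negbTE neq) mulr0.
Qed.

(** * Invariance and regularity of the bracket functions *)

Section InvariantRing.

Variables (K : fieldType) (m n : nat).

Lemma SL_unit (A : SL K m) : sval A \is a GRing.unit.
Proof.
by case: A => A /= /eqP dA; rewrite -[_ \is a _]/(A \in unitmx) unitmxE dA unitr1.
Qed.

Lemma exprz_conj (R : unitRingType) (g a : R) (z : int) :
  g \is a GRing.unit -> a \is a GRing.unit ->
  (g * a * g^-1) ^ z = g * a ^ z * g^-1.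
Proof.
move=> ug ua.
have powE t : (g * a * g^-1) ^+ t = g * a ^+ t * g^-1.
  elim: t => [|t IHt]; first by rewrite !expr0 mulr1 divrr.
  by rewrite !exprS IHt !mulrA mulrVK.
case: z => t; first by rewrite -!exprnP powE.
by rewrite !NegzE -!exprnN powE !invrM ?unitrMl ?unitrX ?unitrV ?invrK ?mulrA.
Qed.

Lemma ext_act (g A : SL K m) (u : n.-tuple 'cV[K]_m.+1) (k : int) :
  ext (sval (SL_conj g A)) (map_tuple (mulmx (sval g)) u) k
  = sval g *m ext (sval A) u k.
Proof.
rewrite /ext /SL_conj /= -[sval g *m _ *m _]/(sval g * sval A * (sval g)^-1).
rewrite exprz_conj ?SL_unit // -[_ * _ * _]/(_ *m _ *m invmx (sval g)).
set j := `|_|%N; rewrite -!mulmxA; do 2 congr (_ *m _).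
(* The lookup leaves the tuple only when [n] is 0; both sides then carry the default vector 0. *)
have [ltjn|lenj] := ltnP j n; last first.
  by rewrite !nth_default ?size_map ?size_tuple // mulmx0.
by rewrite (nth_map 0) ?size_tuple // mulKmx // SL_unit.
Qed.

Lemma bracket_mul (g : SL K m) (u u' : nat -> 'cV[K]_m.+1) :
  (forall j, u' j = sval g *m u j) -> bracket u' = bracket u.
Proof.
move=> u'E; rewrite /bracket.
have -> : \matrix_(r < m.+1, j < m.+1) u' j r 0
    = sval g *m \matrix_(r < m.+1, j < m.+1) u j r 0.
  by apply/matrixP => r j; rewrite !mxE u'E !mxE; apply: eq_bigr => s _; rewrite mxE.
by rewrite det_mulmx (eqP (svalP g)) mul1r.
Qed.

Lemma bracket_fun_invariant (t : family_index m n) :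
  SL_invariant (@bracket_fun K m n t).
Proof.
move=> g x; case: t => [[[i|i]|[i a]]|[i a]] /=; apply: (@bracket_mul g) => j;
  by rewrite /ext_v /ext_w /=; try case: ifP => _; rewrite -ext_act.
Qed.

Lemma coordinate_ring_eq (f g : point K m n -> K) :
  f =1 g -> in_coordinate_ring f -> in_coordinate_ring g.
Proof. by move=> eq_fg [p pE]; exists p => x; rewrite -eq_fg. Qed.

Lemma coordinate_ring_const (c : K) :
  in_coordinate_ring (fun _ : point K m n => c).
Proof. by exists c%:MP => x; rewrite mevalC. Qed.

Lemma coordinate_ring_coord (c : coord_index m n) :
  in_coordinate_ring (@point_coord K m n c).
Proof. by exists 'X_(enum_rank c) => x; rewrite mevalXU enum_rankK. Qed.

Lemma coordinate_ringM (f g : point K m n -> K) :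
  in_coordinate_ring f -> in_coordinate_ring g ->
  in_coordinate_ring (fun x => f x * g x).
Proof. by move=> [p pE] [q qE]; exists (p * q) => x; rewrite mevalM pE qE. Qed.

Lemma coordinate_ring_sum (I : Type) (r : seq I) (f : I -> point K m n -> K) :
  (forall i, in_coordinate_ring (f i)) ->
  in_coordinate_ring (fun x => \sum_(i <- r) f i x).
Proof.
move=> fr; elim: r => [|i r [p pE]].
  by apply: coordinate_ring_eq (coordinate_ring_const 0) => x; rewrite big_nil.
have [q qE] := fr i.
by exists (q + p) => x; rewrite big_cons mevalD pE qE.
Qed.

Lemma coordinate_ring_prod (I : Type) (r : seq I) (f : I -> point K m n -> K) :
  (forall i, in_coordinate_ring (f i)) ->
  in_coordinate_ring (fun x => \prod_(i <- r) f i x).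
Proof.
move=> fr; elim: r => [|i r IHr].
  by apply: coordinate_ring_eq (coordinate_ring_const 1) => x; rewrite big_nil.
by apply: coordinate_ring_eq (coordinate_ringM (fr i) IHr) => x; rewrite big_cons.
Qed.

Lemma coordinate_ring_det (d : nat) (B : point K m n -> 'M[K]_d) :
  (forall i j, in_coordinate_ring (fun x => B x i j)) ->
  in_coordinate_ring (fun x => \det (B x)).
Proof.
move=> Br; apply: coordinate_ring_sum => s.
apply: coordinate_ringM; first exact: coordinate_ring_const.
by apply: coordinate_ring_prod.
Qed.

Lemma coordinate_ring_mulmx (a b c : nat) (B : point K m n -> 'M[K]_(a, b))
    (C : point K m n -> 'M[K]_(b, c)) :
  (forall i j, in_coordinate_ring (fun x => B x i j)) ->
  (forall i j, in_coordinate_ring (fun x => C x i j)) ->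
  forall i j, in_coordinate_ring (fun x => (B x *m C x) i j).
Proof.
move=> Br Cr i j.
apply: coordinate_ring_eq (coordinate_ring_sum _ (f := fun s x => B x i s * C x s j) _).
  by move=> x; rewrite mxE.
by move=> s; apply: coordinate_ringM.
Qed.

Lemma coordinate_ring_expmx (B : point K m n -> 'M[K]_m.+1) (t : nat) :
  (forall i j, in_coordinate_ring (fun x => B x i j)) ->
  forall i j, in_coordinate_ring (fun x => (B x ^+ t) i j).
Proof.
move=> Br; elim: t => [|t IHt] i j.
  exact: coordinate_ring_const.
apply: coordinate_ring_eq (coordinate_ring_mulmx Br IHt i j) => x.
by rewrite exprS.
Qed.

(** Determinant 1 turns the inverse into the adjugate, whose entries are signed minors. This makes
    negative powers of [A], hence vectors of negative index, polynomial. *)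
Lemma coordinate_ring_invSL (i j : 'I_m.+1) :
  in_coordinate_ring (fun x : point K m n => (sval (pA x))^-1 i j).
Proof.
apply: (@coordinate_ring_eq (fun x => (\adj (sval (pA x))) i j)).
  move=> x; rewrite -[_^-1]/(invmx _) /invmx.
  have -> : sval (pA x) \in unitmx by exact: SL_unit.
  by rewrite (eqP (svalP (pA x))) invr1 scale1r.
apply: (@coordinate_ring_eq
  (fun x => (-1) ^+ (j + i) * \det (row' j (col' i (sval (pA x)))))).
  by move=> x; rewrite mxE.
apply: coordinate_ringM; first exact: coordinate_ring_const.
apply: coordinate_ring_det => r s.
apply: coordinate_ring_eq (coordinate_ring_coord (inr (lift j r, lift i s))).
by move=> x; rewrite !mxE.
Qed.

Lemma coordinate_ring_ext (u : point K m n -> n.-tuple 'cV[K]_m.+1) (k : int) :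
  (forall i r, in_coordinate_ring (fun x => tnth (u x) i r 0)) ->
  forall r, in_coordinate_ring (fun x => ext (sval (pA x)) (u x) k r 0).
Proof.
move=> ur r; rewrite /ext; set j := `|_|%N; apply: coordinate_ring_mulmx.
  case: (_ %/ _)%Z => t r' s.
    apply: coordinate_ring_expmx => i i'.
    exact: (coordinate_ring_coord (inr (i, i'))).
  apply: (@coordinate_ring_eq (fun x => ((sval (pA x))^-1 ^+ t.+1) r' s)).
    by move=> x; rewrite NegzE -exprnN exprVn.
  by apply: coordinate_ring_expmx; apply: coordinate_ring_invSL.
move=> s c; rewrite (ord1 c).
have [ltjn|lenj] := ltnP j n.
  apply: coordinate_ring_eq (ur (Ordinal ltjn) s) => x.
  by rewrite (tnth_nth 0).
apply: coordinate_ring_eq (coordinate_ring_const 0) => x.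
by rewrite nth_default ?size_tuple // mxE.
Qed.

Lemma bracket_fun_coordinate_ring (t : family_index m n) :
  in_coordinate_ring (@bracket_fun K m n t).
Proof.
have extv k r : in_coordinate_ring (fun x => @ext_v K m n x k r 0).
  apply: coordinate_ring_ext => i s.
  exact: (coordinate_ring_coord (inl (inl (i, s)))).
have extw k r : in_coordinate_ring (fun x => @ext_w K m n x k r 0).
  apply: coordinate_ring_ext => i s.
  exact: (coordinate_ring_coord (inl (inr (i, s)))).
have bracket_ring (u : point K m n -> nat -> 'cV[K]_m.+1) :
    (forall j r, in_coordinate_ring (fun x => u x j r 0)) ->
    in_coordinate_ring (fun x => bracket (u x)).
  move=> ur; apply: coordinate_ring_det => r j.
  by apply: coordinate_ring_eq (ur j r) => x; rewrite mxE.
by case: t => [[[i|i]|[i a]]|[i a]] /=; apply: bracket_ring => j r //=;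
  case: (j < _)%N.
Qed.

End InvariantRing.

(** * Leading coefficients of vectors under triangular and Hessenberg matrices *)

Section AdaptedVectors.

Variables (K : fieldType) (N : nat).
Implicit Types (M : 'M[K]_N) (q : 'cV[K]_N) (c : K) (t : nat).

(** Membership in step [t] of the standard flag, with leading coefficient [c]; [tailed] is the
    analogue for the opposite flag. As [t] is a plain natural number, [headed] is vacuous for
    [t >= N], whereas [tailed] then forces [q = 0]. *)
Definition headed c t q :=
  (forall i : 'I_N, (t < i)%N -> q i 0 = 0) /\
  (forall i : 'I_N, i = t :> nat -> q i 0 = c).

Definition tailed c t q :=
  (forall i : 'I_N, (i < t)%N -> q i 0 = 0) /\
  (forall i : 'I_N, i = t :> nat -> q i 0 = c).

(** Back substitution: the entries below row [t] vanish from the bottom up, and the unit diagonal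
    preserves the leading one. *)
Lemma headed_upper_solve M c t q :
  (forall i s : 'I_N, (s < i)%N -> M i s = 0) -> (forall i, M i i = 1) ->
  headed c t (M *m q) -> headed c t q.
Proof.
move=> Mup M1 [Mq0 Mqt].
have diagE (i : 'I_N) : (forall s : 'I_N, (i < s)%N -> q s 0 = 0) ->
    (M *m q) i 0 = q i 0.
  move=> qi0; rewrite mxE (bigD1 i) //= M1 mul1r big1 ?addr0 // => s neq_si.
  have [ltsi|ltis|/val_inj eqsi] := ltngtP s i.
  - by rewrite Mup ?mul0r.
  - by rewrite qi0 ?mulr0.
  - by rewrite eqsi eqxx in neq_si.
have q0 (i : 'I_N) : (t < i)%N -> q i 0 = 0.
  have [b] := ubnP (N - i)%N; elim: b i => // b IHb i leb lti.
  rewrite -diagE ?Mq0 // => s ltis; apply: IHb; last exact: ltn_trans ltis.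
  by rewrite (leq_trans (ltn_sub2l (ltn_ord i) ltis)).
split=> // i it; rewrite -(Mqt i it) diagE // => s; rewrite it; exact: q0.
Qed.

(** Forward substitution: the entries above row [t] vanish from the top down, and the leading one is
    divided by the diagonal entry. *)
Lemma tailed_lower_solve M c t q (x : nat -> K) :
  (forall i s : 'I_N, (i < s)%N -> M i s = 0) -> (forall i, M i i = x i) ->
  (forall i, x i != 0) -> tailed c t (M *m q) -> tailed (c / x t) t q.
Proof.
move=> Mlow Mx x0 [Mq0 Mqt].
have diagE (i : 'I_N) : (forall s : 'I_N, (s < i)%N -> q s 0 = 0) ->
    (M *m q) i 0 = x i * q i 0.
  move=> qi0; rewrite mxE (bigD1 i) //= Mx big1 ?addr0 // => s neq_si.
  have [ltsi|ltis|/val_inj eqsi] := ltngtP s i.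
  - by rewrite qi0 ?mulr0.
  - by rewrite Mlow ?mul0r.
  - by rewrite eqsi eqxx in neq_si.
have q0 (i : 'I_N) : (i < t)%N -> q i 0 = 0.
  have [b] := ubnP i; elim: b i => // b IHb i leb ltit.
  apply: (mulfI (x0 i)); rewrite mulr0 -diagE ?Mq0 // => s ltsi.
  by apply: IHb; [exact: leq_trans ltsi leb | exact: ltn_trans ltit].
split=> // i it; apply: (mulfI (x0 i)); rewrite -diagE; last first.
  by move=> s; rewrite it; exact: q0.
by rewrite Mqt // it mulrC divfK.
Qed.

(** In row [t.+1] only column [t] contributes, through a subdiagonal 1, so the head moves down one
    row unchanged. *)
Lemma headed_hessenberg_mul M c t q :
  (forall i s : 'I_N, (s.+1 < i)%N -> M i s = 0) ->
  (forall i s : 'I_N, i = s.+1 :> nat -> M i s = 1) ->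
  headed c t q -> headed c t.+1 (M *m q).
Proof.
move=> M0 M1 [q0 qt]; split=> i lti; rewrite mxE.
  rewrite big1 // => s _; have [lets|ltst] := ltnP t s.
    by rewrite q0 ?mulr0.
  by rewrite M0 ?mul0r // (leq_ltn_trans _ lti).
have ltiN : (i.-1 < N)%N by rewrite (leq_ltn_trans (leq_pred i)).
rewrite (bigD1 (Ordinal ltiN)) //= M1 /= ?lti // mul1r qt /= ?lti //.
rewrite big1 ?addr0 // => s; rewrite -val_eqE /= lti /= => neq_st.
have [lets|ltst|eqst] := ltngtP t s.
- by rewrite q0 ?mulr0.
- by rewrite M0 ?mul0r // lti.
- by rewrite eqst eqxx in neq_st.
Qed.

(** In row [t] only the superdiagonal entry [z t] meets the support of [q], so the tail moves up one
    row and is scaled by it. *)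
Lemma tailed_hessenberg_mul M c t q (z : nat -> K) :
  (t.+1 < N)%N ->
  (forall i s : 'I_N, (i.+1 < s)%N -> M i s = 0) ->
  (forall i s : 'I_N, s = i.+1 :> nat -> M i s = z i) ->
  tailed c t.+1 q -> tailed (z t * c) t (M *m q).
Proof.
move=> ltN M0 Mz [q0 qt]; split=> i lti; rewrite mxE.
  rewrite big1 // => s _; have [lets|ltst] := ltnP s t.+1.
    by rewrite q0 ?mulr0.
  by rewrite M0 ?mul0r // (leq_ltn_trans _ ltst).
rewrite (bigD1 (Ordinal ltN)) //= (Mz i) /= ?lti // qt //.
rewrite big1 ?addr0 // => s; rewrite -val_eqE /= => neq_st.
have [lets|ltst|eqst] := ltngtP s t.+1.
- by rewrite q0 ?mulr0.
- by rewrite M0 ?mul0r // lti.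
- by rewrite eqst eqxx in neq_st.
Qed.

End AdaptedVectors.

(** * Evaluation of a bracket in a basis adapted to two opposite flags *)

Section AdaptedBracket.

Variables (K : fieldType) (m : nat).

Definition rev_from_fun (al : nat) (j : 'I_m.+1) : 'I_m.+1 :=
  if (j < al)%N then j else inord (m + al - j).

Lemma rev_from_val al (j : 'I_m.+1) : (al <= j)%N ->
  rev_from_fun al j = (m + al - j)%N :> nat.
Proof.
move=> lej; rewrite /rev_from_fun (ltnNge j) lej /= inordK //.
by have := ltn_ord j; lia.
Qed.

Lemma rev_from_inj al : injective (rev_from_fun al).
Proof.
apply: (can_inj (g := rev_from_fun al)) => j.
have [ltj|lej] := ltnP j al; first by rewrite /rev_from_fun ltj ltj.
have ltjm := ltn_ord j.
by apply: val_inj => /=; rewrite rev_from_val ?rev_from_val //; lia.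
Qed.

(* The sign of the permutation reversing the columns al, ..., m. *)
Definition rev_sign (al : nat) : K := (-1) ^+ perm (@rev_from_inj al).

Lemma rev_sign_neq0 al : rev_sign al != 0.
Proof. by rewrite signr_eq0. Qed.

(** The tailed columns come with leading rows [m], [m - 1], ...; reversing them puts each leading
    entry on the diagonal. They are supported in rows from [al] on, where [U] below acts as the
    identity, so the permuted matrix is [U *m L] and only the diagonal of [L] and the sign of the
    reversal contribute. *)
Lemma det_adapted (al : nat) (P Q : nat -> 'cV[K]_m.+1) (c : nat -> K) :
  (al <= m.+1)%N ->
  (forall j, (j < al)%N -> headed 1 j (P j)) ->
  (forall j, (j < m.+1 - al)%N -> tailed (c j) (m - j) (Q j)) ->
  \det (\matrix_(r < m.+1, j < m.+1)
          (if (j < al)%N then P j r 0 else Q (j - al)%N r 0))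
  = rev_sign al * \prod_(j < m.+1 - al) c j.
Proof.
move=> leal Phd Qtl; set B := (\matrix_(_, _) _).
pose s := perm (@rev_from_inj al).
(* Both block-diagonal factors of the column-permuted matrix are triangular. *)
pose U := \matrix_(r < m.+1, j < m.+1) (if (j < al)%N then P j r 0 else (r == j)%:R).
pose L := \matrix_(r < m.+1, j < m.+1)
  (if (j < al)%N then (r == j)%:R else Q (m - j)%N r 0).
have Qidx (j : 'I_m.+1) : (al <= j)%N -> (m - j < m.+1 - al)%N.
  by move=> lej; rewrite subSn ?ltnS ?leq_sub2l // (leq_trans lej) // -ltnS.
have BUL : col_perm s B = U *m L.
  apply/matrixP => r j; rewrite !mxE permE.
  have [ltj|lej] := ltnP j al.
    rewrite /rev_from_fun ltj ltj (bigD1 j) //= !mxE ltj eqxx mulr1 big1 ?addr0 //.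
    by move=> i /negbTE neq; rewrite !mxE ltj neq mulr0.
  have ltjm := ltn_ord j.
  rewrite rev_from_val // ltnNge (_ : al <= m + al - j)%N /=; last by lia.
  rewrite (_ : m + al - j - al = m - j)%N; last by lia.
  rewrite (bigD1 r) //= !mxE big1 ?addr0.
    have [ltr|ler] := ltnP r al; last by rewrite eqxx mul1r (ltnNge j) lej.
    rewrite (ltnNge j) lej /=.
    by rewrite (proj1 (Qtl _ (Qidx _ lej))) ?mulr0 //; lia.
  move=> i neq_ir; rewrite !mxE (ltnNge j) lej /=.
  have [lti|lei] := ltnP i al; last by rewrite eq_sym (negbTE neq_ir) mul0r.
  by rewrite (proj1 (Qtl _ (Qidx _ lej))) ?mulr0 //; lia.
have detU : \det U = 1.
  rewrite -det_tr det_trig; last first.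
    apply/is_trig_mxP => i j ltij; rewrite !mxE.
    have [lti|lei] := ltnP i al; first by rewrite (proj1 (Phd _ lti)).
    by case: eqP => // eqij; rewrite eqij ltnn in ltij.
  apply: big1 => i _; rewrite !mxE; have [lti|_] := ltnP i al.
    by rewrite (proj2 (Phd _ lti)).
  by rewrite eqxx.
have detL : \det L = \prod_(j < m.+1 - al) c j.
  rewrite det_trig; last first.
    apply/is_trig_mxP => i j ltij; rewrite !mxE.
    have [ltj|lej] := ltnP j al.
      by case: eqP => // eqij; rewrite eqij ltnn in ltij.
    by rewrite (proj1 (Qtl _ (Qidx _ lej))) //; have := ltn_ord j; lia.
  transitivity (\prod_(j < m.+1) if (j < m.+1 - al)%N then c j else 1).
    rewrite [RHS](reindex_inj rev_ord_inj) /=; apply: eq_bigr => j _.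
    have ltjm := ltn_ord j; rewrite !mxE subSS.
    have [ltj|lej] := ltnP j al; first by rewrite eqxx ltnNge (_ : _ <= _)%N //; lia.
    by rewrite Qidx // (proj2 (Qtl _ (Qidx _ lej))) //; lia.
  by rewrite -big_mkcond /= -big_ord_widen // leq_subr.
have := congr1 determinant BUL.
rewrite det_mulmx detU detL mul1r col_permE det_mulmx det_perm odd_permV => <-.
by rewrite mulrC -mulrA -signr_addb addbb mulr1.
Qed.

Lemma bracket_adapted (E : 'M[K]_m.+1) (al : nat) (u v w : nat -> 'cV[K]_m.+1)
    (c : nat -> K) :
  E \in unitmx -> (al <= m.+1)%N ->
  (forall j, u j = if (j < al)%N then v j else w (j - al)%N) ->
  (forall j, (j < al)%N -> headed 1 j (invmx E *m v j)) ->
  (forall j, (j < m.+1 - al)%N -> tailed (c j) (m - j) (invmx E *m w j)) ->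
  bracket u = rev_sign al * (\det E * \prod_(j < m.+1 - al) c j).
Proof.
move=> uE leal uvw vhd wtl.
rewrite mulrCA -(det_adapted leal vhd wtl) -det_mulmx; congr determinant.
apply/matrixP => r j; rewrite mxE uvw.
rewrite -[LHS](congr1 (fun y : 'cV_m.+1 => y r 0) (mulKVmx uE _)).
by rewrite !mxE; apply: eq_bigr => s _; rewrite !mxE; case: ifP.
Qed.

End AdaptedBracket.

(** * Construction of a point with prescribed nonzero bracket values *)

Lemma residue_lt (n : nat) (n_gt0 : (0 < n)%N) (k : int) :
  (`|((k - 1) %% n%:Z)%Z|%N < n)%N.
Proof.
by rewrite -ltz_nat gez0_abs ?ltz_pmod ?modz_ge0 ?ltz_nat // eqz_nat -lt0n.
Qed.

Section Realization.

Variables (K : fieldType) (m n : nat).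
Hypothesis n_gt0 : (0 < n)%N.
(** Up to sign, [g k t] and [d k t] are the values wanted for (c) and (d) at index [k] with
    [beta = t]. The extreme cases are included: [gd0] holds because [beta = 0] gives the same
    bracket (a) in both, and [gd_max] because [beta = m + 1] in (d) gives (b) at index [k - 1]. *)
Variables g d : int -> nat -> K.
Hypotheses (g_neq0 : forall k t, g k t != 0) (d_neq0 : forall k t, d k t != 0).
Hypothesis g_mod : forall k l t, (k = l %[mod n%:Z])%Z -> g k t = g l t.
Hypothesis d_mod : forall k l t, (k = l %[mod n%:Z])%Z -> d k t = d l t.
Hypothesis gd0 : forall k, g k 0 = d k 0.
Hypothesis gd_max : forall k, g (k - 1) m.+1 = d k m.+1.

(** [W k j] is the leading coefficient intended for w_(k-j) in [frame k], and [D k j] the one for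
    w_(k-1-j) in [half_frame k]; their products over [j] telescope to the prescribed values. *)
Let W k j := g k j.+1 / g k j.
Let D k j := d k j.+1 / d k j.

Let W_neq0 k j : W k j != 0.
Proof. by rewrite mulf_neq0 ?invr_eq0. Qed.

Let D_neq0 k j : D k j != 0.
Proof. by rewrite mulf_neq0 ?invr_eq0. Qed.

Lemma telescope_ratio (h : nat -> K) b :
  (forall t, h t != 0) -> \prod_(j < b) (h j.+1 / h j) = h b / h 0.
Proof.
move=> h0; case: b => [|b]; first by rewrite big_ord0 divff.
by rewrite -(big_mkord xpredT (fun j => h j.+1 / h j)) telescope_prodf.
Qed.

(** The subdiagonal ones advance the heads of the v's; the diagonal converts each coefficient
    [W (k - 1) j] into [D k j]. *)
Let M k : 'M[K]_m.+1 := \matrix_(r, s)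
  (if r == s then W (k - 1) (m - r) / D k (m - r) else (r == s.+1 :> nat)%:R).

(** The unit diagonal preserves the heads of the v's; the superdiagonal converts [D k j] into
    [W k j.+1] while raising the tail by one row. Row [m] has no superdiagonal entry, so the
    predecessor is never taken at 0. *)
Let N k : 'M[K]_m.+1 := \matrix_(r, s)
  (if s == r.+1 :> nat then W k (m - r) / D k (m - r).-1 else (r == s)%:R).

Let det_N k : \det (N k) = 1.
Proof.
rewrite -det_tr det_trig; last first.
  apply/is_trig_mxP => i j ltij; rewrite !mxE.
  by rewrite -val_eqE (ltn_eqF (ltnW ltij : (i < j.+1)%N)) (gtn_eqF ltij).
by apply: big1 => i _; rewrite !mxE eqxx (ltn_eqF (ltnSn i)).
Qed.

(** The diagonal product telescopes to a ratio in which the values at [m.+1] cancel by [gd_max]. *)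
Let det_M k : \det (M k) = g k 0 / g (k - 1) 0.
Proof.
rewrite det_trig; last first.
  apply/is_trig_mxP => i j ltij; rewrite !mxE.
  by rewrite -val_eqE (ltn_eqF ltij) (ltn_eqF (ltnW ltij : (i < j.+1)%N)).
rewrite (reindex_inj rev_ord_inj) /=.
under eq_bigr => i _ do
  rewrite !mxE eqxx /= subSS (subKn (_ : i <= m)%N) -?[(i <= m)%N]ltnS //.
rewrite prodf_div !telescope_ratio // gd_max -gd0 invf_div mulf_div.
by rewrite [X in _ / X]mulrC -mulf_div divff ?mul1r.
Qed.

Let N_unit k : N k \in unitmx.
Proof. by rewrite unitmxE det_N unitr1. Qed.

Let T k := M k *m invmx (N k).

Let det_T k : \det (T k) = g k 0 / g (k - 1) 0.
Proof. by rewrite det_mulmx det_inv det_M det_N invr1 mulr1. Qed.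

Let T_mod k l : (k = l %[mod n%:Z])%Z -> T k = T l.
Proof.
move=> kl; have kl1 : (k - 1 = l - 1 %[mod n%:Z])%Z.
  by rewrite -[LHS]modzDml kl modzDml.
by rewrite /T /M /N; congr (_ *m invmx _); apply/matrixP => r s; rewrite !mxE /W /D
  ?(g_mod _ kl) ?(g_mod _ kl1) ?(d_mod _ kl).
Qed.

(** A starting basis chosen for its determinant [g 1 0]. It is the frame of index 1: [frame_nat i]
    has index [i + 1]. *)
Let E0 : 'M[K]_m.+1 := diag_mx (\row_j (if j == 0 then g 1 0 else 1)).

Fixpoint frame_nat (i : nat) : 'M[K]_m.+1 :=
  if i is i'.+1 then frame_nat i' *m T i.+1%:Z else E0.

Let det_frame_nat i : \det (frame_nat i) = g i.+1%:Z 0.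
Proof.
elim: i => [|i IHi] /=.
  by rewrite det_diag big_ord_recl !mxE eqxx big1 ?mulr1 // => j _; rewrite mxE.
rewrite det_mulmx IHi det_T (_ : i.+2%:Z - 1 = i.+1%:Z); last by lia.
by rewrite mulrC divfK.
Qed.

Let frame_nat_unit i : frame_nat i \in unitmx.
Proof. by rewrite unitmxE det_frame_nat unitfE. Qed.

Let monodromy := frame_nat n *m invmx (frame_nat 0).

Let det_monodromy : \det monodromy == 1.
Proof.
rewrite det_mulmx det_inv !det_frame_nat (g_mod (l := 1)) ?divff //.
by rewrite -addn1 PoszD modzDl.
Qed.

Let A : SL K m := exist (fun B : 'M[K]_m.+1 => is_true (\det B == 1)) _ det_monodromy.

Let frame (k : int) : 'M[K]_m.+1 :=
  (monodromy ^ ((k - 1) %/ n%:Z)%Z : 'M[K]_m.+1)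
    *m frame_nat `|((k - 1) %% n%:Z)%Z|%N.

Let monodromy_unit : (monodromy : 'M[K]_m.+1) \is a GRing.unit.
Proof. exact: (SL_unit A). Qed.

Let frameS k : frame (k + 1) = frame k *m T (k + 1).
Proof.
have n0 : n%:Z != 0 by rewrite eqz_nat -lt0n.
pose q := ((k - 1) %/ n%:Z)%Z; pose r := `|((k - 1) %% n%:Z)%Z|%N.
have rE : ((k - 1) %% n%:Z)%Z = r by rewrite gez0_abs // modz_ge0.
have ltrn : (r < n)%N by rewrite -ltz_nat -rE ltz_pmod // ltz_nat.
have kE : k = q * n%:Z + r%:Z + 1 by rewrite -rE -divz_eq subrK.
have TE : T (k + 1) = T r.+2%:Z.
  apply: T_mod; rewrite kE -!addrA modzMDl; congr (_ %% _)%Z; lia.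
rewrite TE {2}/frame -/q rE absz_nat -mulmxA -[frame_nat r *m _]/(frame_nat r.+1).
(* Within a period this is the recursion of [frame_nat]; at [r.+1 = n] the quotient grows by one,
   and the extra factor [monodromy] carries [frame_nat 0] to [frame_nat n]. *)
rewrite /frame addrK; have [ltrn1|lenr] := ltnP r.+1 n.
  have kE' : k = q * n%:Z + r.+1%:Z by rewrite kE; lia.
  by rewrite kE' divzMDl // modzMDl divz_small ?modz_small ?addr0 //; lia.
have rn : r.+1 = n by apply/eqP; rewrite eqn_leq ltrn lenr.
have kE' : k = (q + 1) * n%:Z + 0 by rewrite kE -rn; lia.
rewrite kE' divzMDl // modzMDl div0z mod0z addr0 rn absz0.
rewrite exprzDr // expr1z -[_ * _]/(_ *m _) -mulmxA; congr (_ *m _).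
by rewrite /monodromy -mulmxA mulVmx // mulmx1.
Qed.

Let det_frame k : \det (frame k) = g k 0.
Proof.
have n0 : n%:Z != 0 by rewrite eqz_nat -lt0n.
have detX t : \det ((monodromy : 'M_m.+1) ^+ t) = 1.
  elim: t => [|t IHt]; first by rewrite det1.
  by rewrite exprS detM IHt (eqP det_monodromy) mulr1.
rewrite det_mulmx det_frame_nat.
have -> : \det (monodromy ^ ((k - 1) %/ n%:Z)%Z : 'M_m.+1) = 1.
  case: (_ %/ _)%Z => t; first exact: detX.
  by rewrite NegzE -exprnN -[(_ ^+ _)^-1]/(invmx _) det_inv detX invr1.
rewrite mul1r; apply: g_mod.
by rewrite -[_.+1]addn1 PoszD gez0_abs ?modz_ge0 // modzDml subrK.
Qed.

Let frame_unit k : frame k \in unitmx.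
Proof. by rewrite unitmxE det_frame unitfE. Qed.

(* The basis compatible with both the flag of v_k, v_{k+1}, ... and the flag
   of w_{k-1}, w_{k-2}, ...; frame k plays this role for w_k, w_{k-1}, .... *)
Let half_frame k := frame k *m N k.

Let half_frame_unit k : half_frame k \in unitmx.
Proof. by rewrite unitmx_mul frame_unit N_unit. Qed.

Let half_frameE k : half_frame k = frame (k - 1) *m M k.
Proof.
rewrite /half_frame -{1}(subrK 1 k) frameS subrK /T !mulmxA.
by rewrite mulmxKV.
Qed.

Let half_frame_coords k (u : 'cV[K]_m.+1) :
  N k *m (invmx (half_frame k) *m u) = invmx (frame k) *m u.
Proof.
apply: (can_inj (mulKmx (frame_unit k))).
by rewrite mulKVmx // mulmxA -/(half_frame k) mulKVmx.
Qed.

Let half_frame_coords_pred k (u : 'cV[K]_m.+1) :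
  M k *m (invmx (half_frame k) *m u) = invmx (frame (k - 1)) *m u.
Proof.
apply: (can_inj (mulKmx (frame_unit (k - 1)))).
by rewrite mulKVmx // mulmxA -half_frameE mulKVmx.
Qed.

Definition realization : point K m n := Point
  [tuple frame_nat (i : 'I_n) *m delta_mx 0 0 | i < n]
  [tuple W i.+1%:Z 0 *: (frame_nat (i : 'I_n) *m delta_mx ord_max 0) | i < n]
  A.

Let ext_v_realization k : ext_v realization k = frame k *m delta_mx 0 0.
Proof.
rewrite /ext_v /ext.
rewrite -[nth _ _ _](tnth_nth 0 (pv realization) (Ordinal (residue_lt n_gt0 k))).
by rewrite tnth_mktuple mulmxA.
Qed.

Let ext_w_realization k :
  ext_w realization k = W k 0 *: (frame k *m delta_mx ord_max 0).
Proof.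
rewrite /ext_w /ext.
rewrite -[nth _ _ _](tnth_nth 0 (pw realization) (Ordinal (residue_lt n_gt0 k))).
rewrite tnth_mktuple -scalemxAr mulmxA; congr (_ *: _).
(* The scalar is stored at the representative of [k] in 1, ..., [n]; periodicity of [g] identifies
   it with [W k 0]. *)
have kE : (`|((k - 1) %% n%:Z)%Z|.+1%:Z = k %[mod n%:Z])%Z.
  rewrite -[_.+1]addn1 PoszD gez0_abs ?modz_ge0 ?modzDml ?subrK //.
  by rewrite eqz_nat -lt0n.
by rewrite /= /W !(g_mod _ kE).
Qed.

Let headed_half_frame k u :
  forall t, headed 1 t (invmx (frame k) *m u) -> headed 1 t (invmx (half_frame k) *m u).
Proof.
move=> t; rewrite -half_frame_coords; apply: headed_upper_solve => [i s ltsi|i].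
  by rewrite !mxE -val_eqE (gtn_eqF ltsi) (ltn_eqF (ltnW ltsi : (s < i.+1)%N)).
by rewrite !mxE eqxx (ltn_eqF (ltnSn i)).
Qed.

(** Induction on [j]: the head of v_(k+1+j) in [frame (k + 1)] persists in the half frame, and
    [M (k + 1)] lowers it by one row in [frame k]. *)
Let headed_frame j k :
  headed 1 j (invmx (frame k) *m ext_v realization (k + j%:Z)).
Proof.
elim: j k => [|j IHj] k.
  rewrite addr0 ext_v_realization mulKmx //.
  by split=> i; rewrite mxE -val_eqE => hi; rewrite eqxx andbT;
    [rewrite (gtn_eqF hi) | rewrite /= hi].
have -> : k + j.+1%:Z = (k + 1) + j%:Z by lia.
have := headed_half_frame (IHj (k + 1)).
have := half_frame_coords_pred (k + 1); rewrite addrK => <-.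
apply: headed_hessenberg_mul => i s ltsi; rewrite !mxE -val_eqE.
  by rewrite (gtn_eqF ltsi) (gtn_eqF (ltnW ltsi)).
by rewrite /= ltsi eqxx (gtn_eqF (ltnSn s)).
Qed.

Let tailed_half_frame j k u : (j <= m)%N ->
  tailed (W (k - 1) j) (m - j) (invmx (frame (k - 1)) *m u) ->
  tailed (D k j) (m - j) (invmx (half_frame k) *m u).
Proof.
move=> lejm tl; pose x i := W (k - 1) (m - i) / D k (m - i).
have -> : D k j = W (k - 1) j / x (m - j)%N.
  by rewrite /x subKn // invf_div mulrC divfK.
apply: (@tailed_lower_solve _ _ (M k)); last by rewrite half_frame_coords_pred.
- move=> i s ltis; rewrite !mxE -val_eqE.
  by rewrite (ltn_eqF ltis) (ltn_eqF (ltnW ltis : (i < s.+1)%N)).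
- by move=> i; rewrite !mxE eqxx.
- by move=> i; rewrite mulf_neq0 ?invr_eq0.
Qed.

(** Induction on [j]: the tail of w_(k-1-j) in [frame (k - 1)] becomes [D k j] in the half frame,
    and [N k] raises it to row [m - j.+1] with coefficient [W k j.+1]. *)
Let tailed_frame j k : (j <= m)%N ->
  tailed (W k j) (m - j) (invmx (frame k) *m ext_w realization (k - j%:Z)).
Proof.
elim: j k => [|j IHj] k lejm.
  rewrite subr0 subn0 ext_w_realization -scalemxAr mulKmx //.
  by split=> i; rewrite !mxE -val_eqE => hi; rewrite eqxx andbT /=;
    [rewrite (ltn_eqF hi) mulr0 | rewrite hi eqxx mulr1].
have -> : k - j.+1%:Z = (k - 1) - j%:Z by lia.
have := tailed_half_frame (ltnW lejm) (IHj (k - 1) (ltnW lejm)).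
rewrite -half_frame_coords.
pose z i := W k (m - i) / D k (m - i).-1.
have -> : W k j.+1 = z (m - j.+1)%N * D k j by rewrite /z subKn //= divfK.
rewrite -[(m - j)%N](_ : (m - j.+1).+1 = _); last by lia.
apply: tailed_hessenberg_mul => [|i s ltis|i s sE]; first by lia.
  by rewrite !mxE -val_eqE (gtn_eqF ltis) (ltn_eqF (ltnW ltis)).
by rewrite !mxE sE eqxx.
Qed.

(** The determinant [g k 0] of the frame cancels the denominator of the telescoped product of the
    [W k j]. *)
Lemma fun_c_realization k al : (al <= m.+1)%N ->
  fun_c k al realization = rev_sign K m al * g k (m.+1 - al).
Proof.
move=> leal.
rewrite /fun_c (@bracket_adapted _ _ (frame k) al _
  (fun j => ext_v realization (k + j%:Z))
  (fun j => ext_w realization (k - j%:Z)) (W k)) //.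
- by rewrite det_frame (@telescope_ratio (g k)) // [g k 0 * _]mulrC divfK.
- by move=> j ltj; apply: tailed_frame; lia.
Qed.

Lemma fun_d_realization k al : (al <= m.+1)%N ->
  fun_d k al realization = rev_sign K m al * d k (m.+1 - al).
Proof.
move=> leal.
rewrite /fun_d (@bracket_adapted _ _ (half_frame k) al _
  (fun j => ext_v realization (k + j%:Z))
  (fun j => ext_w realization (k - 1 - j%:Z)) (D k)) //.
- rewrite det_mulmx det_N mulr1 det_frame (@telescope_ratio (d k)) //.
  by rewrite gd0 [d k 0 * _]mulrC divfK.
- by move=> j ltj; apply: headed_half_frame.
- by move=> j ltj; apply: tailed_half_frame; [|apply: tailed_frame]; lia.
Qed.

End Realization.

(** * Surjectivity onto the torus and algebraic independence *)

Section AlgebraicIndependence.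

Variables (m n : nat).
Hypothesis n_gt0 : (0 < n)%N.

Let idx k : 'I_n := Ordinal (residue_lt n_gt0 k).

Let idx_mod k l : (k = l %[mod n%:Z])%Z -> idx k = idx l.
Proof.
by move=> kl; apply: val_inj; rewrite /= -[((k - 1) %% _)%Z]modzDml kl modzDml.
Qed.

Let idxS (i : 'I_n) : idx i.+1%:Z = i.
Proof.
apply: val_inj; rewrite /= (_ : i.+1%:Z - 1 = i%:Z); last by lia.
by rewrite modz_small //= ltz_nat ltn_ord.
Qed.

Lemma bracket_fun_torus_surj (K : fieldType) (f : family_index m n -> K) :
  (forall t, f t != 0) -> exists x, forall t, bracket_fun t x = f t.
Proof.
move=> f0.
(* The value wanted for a bracket with [al] vectors v: (b) at [l] for [al = 0], (a) at [k] for
   [al = m.+1], where [insub] fails, and (c) or (d) in between. *)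
pose val (ca : 'I_n * 'I_m -> family_index m n) (k l : int) (al : nat) :=
  if al is al'.+1 then
    if insub al' is Some a then f (ca (idx k, a)) else f (inl (inl (inl (idx k))))
  else f (inl (inl (inr (idx l)))).
have val_neq0 ca k l al : val ca k l al != 0.
  by rewrite /val; case: al => // al; case: insub.
(* Here [t] is beta; dividing by [rev_sign] cancels the sign of the column reversal. *)
pose g k t := val (fun ka => inl (inr ka)) k k (m.+1 - t)%N / rev_sign K m (m.+1 - t).
pose d k t := val inr k (k - 1) (m.+1 - t)%N / rev_sign K m (m.+1 - t).
have g_neq0 k t : g k t != 0 by rewrite mulf_neq0 ?invr_eq0 ?rev_sign_neq0.
have d_neq0 k t : d k t != 0 by rewrite mulf_neq0 ?invr_eq0 ?rev_sign_neq0.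
have g_mod k l t : (k = l %[mod n%:Z])%Z -> g k t = g l t.
  by move=> kl; rewrite /g /val (idx_mod kl).
have d_mod k l t : (k = l %[mod n%:Z])%Z -> d k t = d l t.
  move=> kl; rewrite /d /val (idx_mod kl) (@idx_mod (k - 1) (l - 1)) //.
  by rewrite -[LHS]modzDml kl modzDml.
have insub_m : insub m = None :> option 'I_m by rewrite insubF // ltnn.
have gd0 k : g k 0 = d k 0 by rewrite /g /d subn0 /val insub_m.
have gd_max k : g (k - 1) m.+1 = d k m.+1 by rewrite /g /d subnn.
pose x := realization n_gt0 g_neq0 d_neq0 g_mod gd0 gd_max.
have fun_cE k al : (al <= m.+1)%N ->
    fun_c k al x = val (fun ka => inl (inr ka)) k k al.
  move=> leal; rewrite fun_c_realization // /g subKn //.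
  by rewrite mulrC divfK ?rev_sign_neq0.
have fun_dE k al : (al <= m.+1)%N -> fun_d k al x = val inr k (k - 1) al.
  move=> leal; rewrite fun_d_realization // /d subKn //.
  by rewrite mulrC divfK ?rev_sign_neq0.
exists x; case=> [[[i|i]|[i a]]|[i a]] /=.
(* (a) and (b) are the extreme cases [alpha = m.+1] and [alpha = 0] of (c). *)
- transitivity (fun_c i.+1%:Z m.+1 x); last by rewrite fun_cE //= insub_m idxS.
  by congr determinant; apply/matrixP => r j; rewrite mxE [RHS]mxE ltn_ord.
- transitivity (fun_c i.+1%:Z 0 x); last by rewrite fun_cE //= idxS.
  by congr determinant; apply/matrixP => r j; rewrite mxE [RHS]mxE subn0.
- by rewrite fun_cE; [rewrite /= valK idxS | rewrite ltnS ltnW].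
- by rewrite fun_dE; [rewrite /= valK idxS | rewrite ltnS ltnW].
Qed.

Lemma bracket_fun_alg_independent (F : numFieldType) :
  alg_independent (@bracket_fun F m n).
Proof.
move=> p p0; apply: mpoly_eq0_off_hyperplanes => y y0.
have [t|x xE] := @bracket_fun_torus_surj F (fun t => y (enum_rank t)).
  exact: y0.
by rewrite -(p0 x); apply: meval_eq => k; rewrite xE enum_valK.
Qed.

End AlgebraicIndependence.

(* R[i] is the field of complex numbers over the real numbers R. *)
Theorem mainTheorem4 (R : realType) (m n : nat)
    (hm : (1 <= m)%N) (hn : (1 <= n)%N) :
  (forall t : family_index m n,
     in_invariant_ring (@bracket_fun (complex R) m n t)) /\
  alg_independent (@bracket_fun (complex R) m n).
Proof.
split; last exact: bracket_fun_alg_independent.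
move=> t; split; first exact: bracket_fun_coordinate_ring.
exact: bracket_fun_invariant.
Qed.
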